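(* There exists no binary orthogonal array of parameters $(n,M,\tau)=(9,96,4)$, i.e. of length $9$, cardinality $96=6\cdot 2^4$ and strength $4$.
   Context: A binary orthogonal array of parameters $(n,M,\tau)$ is the multiset of rows of an $M\times n$ binary matrix such that every $M\times\tau$ submatrix contains each ordered $\tau$-tuple of $\{0,1\}^\tau$ exactly $M/2^\tau$ times as rows. *)

(* Defs.v *)
From mathcomp Require Import all_boot all_algebra.
Set Implicit Arguments. Unset Strict Implicit. Unset Printing Implicit Defensive.

Definition is_binary_OA (n M tau : nat) (A : 'M[bool]_(M, n)) : Prop :=
  forall (c : 'I_tau -> 'I_n), injective c ->
  forall (t : 'I_tau -> bool),
    #|[set i : 'I_M | [forall j : 'I_tau, A i (c j) == t j]]| * 2 ^ tau = M.

(* Main.v *)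
(* Adjoin to the nine columns a tenth, constant one, and write F(U) for the sum over the rows of the
   product of the signs in the columns of U. By strength 4, F(U) = 0 for even 1 <= |U| <= 4, and
   for A nonempty the sum of F(U) over the even subsets U of A is 2^(|A|-1) times the number of
   rows constant on A. Hence F(U) = 32 k(U) with k(U) an integer for |U| = 6 and 8.
   A linear programming bound on the distances to a given row shows that the rows are distinct, so
   Parseval's identity gives sum k(U)^2 <= 39 over |U| = 6, 8. In particular at most 39 of the k(U)
   are odd.
   Modulo 2, the subset sums say: a 7-set contains an odd number of odd 6-sets; in an 8-set A, the
   number of odd 6-sets plus k(A) is odd; in a 9-set, the number of odd 6-sets and 8-sets is odd.
   Let n6 and n8 be the numbers of odd 6-sets and 8-sets. Counting 7-sets, each 8-set contains at
   least 4 odd 6-sets, and at least 5 if it is not itself odd, so 6 n6 + n8 >= 5 * 45; each 9-set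
   contains an even number of odd 6-sets, hence an odd 8-set, so 2 n8 >= 10. Therefore
   6 (n6 + n8) >= 250 > 6 * 39, a contradiction. *)
Require Import Defs.
From mathcomp Require Import all_boot all_order all_algebra.
From mathcomp Require Import zify.
Set Implicit Arguments. Unset Strict Implicit. Unset Printing Implicit Defensive.
Import GRing.Theory Num.Theory Order.TTheory.

(** * Double counting of subsets and the parity bound *)

Definition subsets_of_size (T : finType) (k : nat) (B : {set T}) : pred {set T} :=
  fun A => (A \subset B) && (#|A| == k).

Lemma card_subsets_between (T : finType) (U B : {set T}) (k : nat) :
  U \subset B ->
  #|[set A | subsets_of_size (#|U| + k) B A && (U \subset A)]| = 'C(#|B| - #|U|, k).
Proof.
move=> sUB; have disj (D : {set T}) : D \subset B :\: U -> U :&: D = set0.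
  move=> /subsetP sD; apply/setP=> z; rewrite !inE.
  by case: (boolP (z \in D)) => [/sD|]; rewrite ?inE ?andbF // => /andP[/negPf-> _].
have -> : #|B| - #|U| = #|B :\: U| by rewrite cardsD (setIidPr sUB).
rewrite -cards_draws -[RHS](card_in_imset (f := fun D => U :|: D)); last first.
  move=> D E; rewrite !inE => /andP[/disj dD _] /andP[/disj dE _] eqDE.
  apply/setP=> z; move/setP/(_ z): eqDE; move/setP/(_ z): dD; move/setP/(_ z): dE.
  by rewrite !inE; case: (z \in U); case: (z \in D); case: (z \in E).
congr #|pred_of_set _|; apply/setP=> A; rewrite !inE /subsets_of_size.
apply/idP/imsetP => [/andP[/andP[sAB /eqP cA] sUA]|[D]].
  exists (A :\: U); last first.
    by apply/setP=> z; rewrite !inE; move/subsetP/(_ z): sUA; case: (z \in U) => // ->.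
  by rewrite inE setSD //= cardsD (setIidPr sUA) cA addKn.
rewrite inE => /andP[sD /eqP cD] ->; rewrite subUset sUB (subset_trans sD (subsetDl _ _)) /=.
by rewrite cardsU disj // cards0 subn0 cD eqxx subsetUl.
Qed.

(** After exchanging the sums, each [j]-subset [U] of [B] is counted once for every [(j + k)]-subset
    of [B] above it. *)
Lemma double_count_subsets (T : finType) (x : {set T} -> nat) (j k : nat) (B : {set T}) :
  \sum_(A | subsets_of_size (j + k) B A) \sum_(U | subsets_of_size j A U) x U =
  (\sum_(U | subsets_of_size j B U) x U) * 'C(#|B| - j, k).
Proof.
rewrite (exchange_big_dep (subsets_of_size j B)) /=; last first.
  move=> A U /andP[sAB _] /andP[sUA cU].
  by rewrite /subsets_of_size (subset_trans sUA sAB).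
rewrite big_distrl; apply: eq_bigr => U /andP[sUB /eqP cU].
rewrite sum_nat_const -[in RHS]cU -card_subsets_between // mulnC; congr (_ * _).
apply: eq_card => A; rewrite !inE unfold_in /= /subsets_of_size cU eqxx andbT.
by [].
Qed.

Lemma sum_subsets_of_size_const (T : finType) (k c : nat) (B : {set T}) :
  \sum_(A | subsets_of_size k B A) c = 'C(#|B|, k) * c.
Proof.
by rewrite sum_nat_const -cards_draws; congr (_ * _); apply: eq_card => A; rewrite !inE.
Qed.

Lemma odd_sum_odd (I : finType) (P : pred I) (F : I -> nat) :
  (forall i, P i -> odd (F i)) -> odd (\sum_(i | P i) F i) = odd #|[pred i | P i]|.
Proof.
move=> oF; rewrite -sum1_card (big_morph odd oddD (erefl _)) (big_morph odd oddD (erefl _)).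
by apply: eq_bigr => i /oF ->.
Qed.

Lemma parity_weight_bound (T : finType) (x : {set T} -> bool) :
  let X k (A : {set T}) := \sum_(U | subsets_of_size k A U) x U in
  #|T| = 10 ->
  (forall A : {set T}, #|A| = 7 -> odd (X 6 A)) ->
  (forall A : {set T}, #|A| = 8 -> odd (X 6 A + x A)) ->
  (forall A : {set T}, #|A| = 9 -> odd (X 6 A + X 8 A)) ->
  39 < X 6 [set: T] + X 8 [set: T].
Proof.
move=> X cT h7 h8 h9.
have cTT : #|[set: T]| = 10 by rewrite cardsT.
have X8_ge (A : {set T}) : #|A| = 8 -> 5 <= X 6 A + x A.
  move=> cA; have := double_count_subsets (fun U => x U) 6 1 A; rewrite cA /= -/(X 6 A) => e.
  (* Each of the eight 7-subsets contains a 6-set with [x] true, and each 6-set lies in two of them,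
     so [X 6 A] is at least 4. When [x A] is false, [h8] makes [X 6 A] odd and so excludes 4. *)
  have : \sum_(B | subsets_of_size 7 A B) 1 <= X 6 A * 2.
    rewrite -[2]/('C(8 - 6, 1)) -e; apply: leq_sum => B /andP[_ /eqP /h7].
    by rewrite -/(X 6 B); case: (X 6 B).
  rewrite sum_subsets_of_size_const cA => ge4.
  have {}ge4 : 4 <= X 6 A by move: ge4; rewrite (_ : 'C(8, 7) = 8) //; lia.
  by move: (h8 A cA); rewrite oddD; case: (x A) => /=; lia.
have X9_ge (A : {set T}) : #|A| = 9 -> 1 <= X 8 A.
  move=> cA; have := double_count_subsets (fun U => x U) 6 1 A; rewrite cA /= -/(X 6 A) => e.
  (* The 36 odd values [X 6 B] have an even sum, which is [X 6 A * 3]. Hence [X 6 A] is even, and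
     [h9] makes [X 8 A] odd. *)
  have := @odd_sum_odd _ (subsets_of_size 7 A) (X 6) (fun B sB => h7 B (eqP (andP sB).2)).
  rewrite e -sum1_card (sum_subsets_of_size_const 7 1 A) cA oddM.
  rewrite (_ : 'C(9, 7) = 36) // (_ : 'C(9 - 6, 1) = 3) //= andbT => eX6.
  by move: (h9 A cA); rewrite oddD eX6 /=; case: (X 8 A).
have := double_count_subsets (fun U => x U) 6 2 [set: T]; have := double_count_subsets (fun U => x U) 8 1 [set: T].
rewrite cTT (_ : 'C(10 - 6, 2) = 6) // (_ : 'C(10 - 8, 1) = 2) // => e8 e6.
have n8_ge : 5 <= X 8 [set: T].
  have : \sum_(B | subsets_of_size 9 [set: T] B) 1 <= X 8 [set: T] * 2.
    by rewrite -e8; apply: leq_sum => B /andP[_ /eqP /X9_ge].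
  by rewrite sum_subsets_of_size_const cTT (_ : 'C(10, 9) = 10) //; lia.
have : \sum_(B | subsets_of_size 8 [set: T] B) 5 <= X 6 [set: T] * 6 + X 8 [set: T].
  by rewrite -e6 -big_split; apply: leq_sum => B /andP[_ /eqP /X8_ge].
rewrite sum_subsets_of_size_const cTT (_ : 'C(10, 8) = 45) //; lia.
Qed.

Local Open Scope ring_scope.

(** * Sign vectors constant on a set *)

Definition constant_on (T : finType) (sigma : T -> int) (A : {set T}) : bool :=
  [forall p in A, forall q in A, sigma p == sigma q].

Lemma constant_onP (T : finType) (sigma : T -> int) (A : {set T}) :
  reflect {in A &, forall p q, sigma p = sigma q} (constant_on sigma A).
Proof.
apply: (iffP idP) => [/forall_inP h p q /h/forall_inP hp /hp/eqP //|h].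
by apply/forall_inP => p pA; apply/forall_inP => q qA; apply/eqP/h.
Qed.

Lemma sum_subsets_prod (R : comPzRingType) (T : finType) (f : T -> R) (A : {set T}) :
  \sum_(U : {set T} | U \subset A) \prod_(p in U) f p = \prod_(p in A) (1 + f p).
Proof.
rewrite [RHS]big_mkcond (eq_bigr (fun p => (if p \in A then f p else 0) + 1)); last first.
  by move=> p _; case: ifP; rewrite ?add0r // addrC.
rewrite bigA_distr [LHS]big_mkcond; apply: eq_bigr => U _.
case: ifP => [sUA | /negP nUA].
  rewrite [LHS]big_mkcond; apply: eq_bigr => p _; case: ifP => // pU.
  by rewrite (subsetP sUA).
have /subsetPn[p pU /negPf npA] : ~~ (U \subset A) by apply/negP.
by rewrite (bigD1 p) //= pU npA mul0r.
Qed.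

(** Adding the expansions of the products of [1 + sigma p] and of [1 - sigma p] cancels the odd
    subsets and doubles the even ones. Both products vanish if both signs occur on [A]; otherwise
    one vanishes and the other is [2 ^+ #|A|]. *)
Lemma sum_even_subsets_prod (T : finType) (sigma : T -> int) (A : {set T}) :
  (forall p, sigma p = 1 \/ sigma p = -1) -> A != set0 ->
  \sum_(U : {set T} | (U \subset A) && ~~ odd #|U|) \prod_(p in U) sigma p
  = 2 ^+ #|A|.-1 * (constant_on sigma A)%:R.
Proof.
move=> sg /set0Pn[a aA].
have cA : #|A| = #|A|.-1.+1 by rewrite prednK //; apply/card_gt0P; exists a.
apply: (@mulfI _ 2) => //; rewrite mulrA -exprS -cA.
have -> : 2 * \sum_(U : {set T} | (U \subset A) && ~~ odd #|U|) \prod_(p in U) sigma p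
  = \prod_(p in A) (1 + sigma p) + \prod_(p in A) (1 + - sigma p).
  rewrite -!sum_subsets_prod -big_split big_distrr /= big_mkcondr; apply: eq_bigr => U _.
  rewrite prodrN -signr_odd; move: (\prod_(_ in _) _) => z.
  by case: (odd _) => /=; lia.
have prod0 (tau : T -> int) p : p \in A -> tau p = 0 -> \prod_(q in A) tau q = 0.
  by move=> pA t0; rewrite (bigD1 p) //= t0 mul0r.
case: constant_onP => [h|h]; rewrite ?mulr1 ?mulr0.
  case: (sg a) => sa.
    rewrite [X in _ + X](prod0 _ a) // ?sa // addr0.
    by rewrite (eq_bigr (fun=> 2)) ?prodr_const // => p pA; rewrite (h p a) // sa.
  rewrite [X in X + _](prod0 _ a) // ?sa // add0r.
  by rewrite (eq_bigr (fun=> 2)) ?prodr_const // => p pA; rewrite (h p a) // sa.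
have [p pA sp] : exists2 p, p \in A & sigma p != sigma a.
  apply/exists_inP; apply: contra_notT h; rewrite negb_exists_in => /forall_inP h p q pA qA.
  by move: (h p pA) (h q qA); rewrite !negbK => /eqP-> /eqP->.
case: (sg a) sp => sa; case: (sg p) => sp; rewrite sa sp // => _.
  by rewrite [X in X + _](prod0 _ p) ?[X in _ + X](prod0 _ a) ?sa ?sp.
by rewrite [X in X + _](prod0 _ a) ?[X in _ + X](prod0 _ p) ?sa ?sp.
Qed.

(** A constant set lies in the plus part or in the minus part, and not in both because [0 < k]
    excludes the empty set. *)
Lemma sum_constant_on_subsets (T : finType) (sigma : T -> int) (k : nat) :
  (forall p, sigma p = 1 \/ sigma p = -1) -> (0 < k)%N ->
  (\sum_(A | subsets_of_size k [set: T] A) constant_on sigma A =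
   'C(#|[set p | sigma p == 1]|, k) + 'C(#|T| - #|[set p | sigma p == 1]|, k))%N.
Proof.
move=> sg k_gt0; set P := [set p | _].
have -> : (#|T| - #|P|)%N = #|~: P| by rewrite [RHS]cardsCs setCK.
transitivity (\sum_(A | subsets_of_size k [set: T] A) ((A \subset P) + (A \subset ~: P)))%N.
  apply: eq_bigr => A /andP[_ /eqP cA].
  have [a aA] : exists a, a \in A by apply/card_gt0P; rewrite cA.
  have notboth : A \subset P -> A \subset ~: P -> False.
    by move=> /subsetP/(_ a aA) aP /subsetP/(_ a aA); rewrite inE aP.
  case: constant_onP => h; last first.
    case: (boolP (A \subset P)) => [/subsetP sA|_].
      case: h => p q /sA + /sA; rewrite !inE => /eqP-> /eqP-> //.
    case: (boolP (A \subset ~: P)) => [/subsetP sA|//].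
    case: h => p q /sA + /sA; rewrite !inE.
    by case: (sg p) => ->; case: (sg q) => ->.
  have : (A \subset P) || (A \subset ~: P).
    case: (sg a) => sa; apply/orP; [left|right]; apply/subsetP => p pA;
      by rewrite !inE (h p a pA aA) sa.
  by move: notboth; do 2!case: (_ \subset _) => //; case.
rewrite big_split /= -2!cards_draws -!sum1_card.
by congr (_ + _)%N; rewrite -big_mkcondr; apply: eq_bigl => A;
  rewrite !inE /subsets_of_size subsetT andbC.
Qed.

Lemma odd_absz_sum (I : finType) (P : pred I) (F : I -> int) :
  odd `|\sum_(i | P i) F i| = odd (\sum_(i | P i) odd `|F i|)%N.
Proof.
have oD : {morph (fun z : int => odd `|z|) : a b / a + b >-> a (+) b} by move=> a b; lia.
rewrite (big_morph _ oD (erefl _)) (big_morph odd oddD (erefl _)).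
by apply: eq_bigr => i _; rewrite oddb.
Qed.

(** * Fourier coefficients and distinctness of rows *)

Definition fourier (I T : finType) (s : I -> T -> int) (U : {set T}) : int :=
  \sum_r \prod_(p in U) s r p.

Lemma fourier0 (I T : finType) (s : I -> T -> int) : fourier s set0 = #|I|%:R.
Proof. by rewrite /fourier (eq_bigr (fun=> 1)) ?sumr_const // => r _; rewrite big_set0. Qed.

Lemma sign_mul (x y : int) : x = 1 \/ x = -1 -> y = 1 \/ y = -1 -> x * y = 1 \/ x * y = -1.
Proof. by case=> -> [] ->; [left|right|right|left]. Qed.

(** The twist [e] serves two purposes: [e = 1] counts the rows constant on [A], and [e = s i] counts
    the rows equal on [A] to row [i] up to a common sign. *)
Lemma sum_constant_on_fourier (I T : finType) (s : I -> T -> int) (e : T -> int) (A : {set T}) :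
  (forall p, e p = 1 \/ e p = -1) -> (forall r p, s r p = 1 \/ s r p = -1) -> A != set0 ->
  2 ^+ #|A|.-1 * (\sum_r constant_on (fun p => (e p * s r p)%R) A)%N%:R
  = \sum_(U : {set T} | (U \subset A) && ~~ odd #|U|) (\prod_(p in U) e p) * fourier s U.
Proof.
move=> sge sgs nA; rewrite natr_sum big_distrr /=.
rewrite (eq_bigr (fun r => \sum_(U : {set T} | (U \subset A) && ~~ odd #|U|)
    \prod_(p in U) (e p * s r p))); last first.
  by move=> r _; rewrite sum_even_subsets_prod // => p; apply: sign_mul.
rewrite exchange_big; apply: eq_bigr => U _; rewrite /fourier big_distrr.
by apply: eq_bigr => r _; rewrite big_split.
Qed.

(** Nonempty even subsets of [A] have size 2 or 4, so only the empty set contributes. *)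
Lemma strength5_count (I T : finType) (s : I -> T -> int) (e : T -> int) (A : {set T}) :
  (forall p, e p = 1 \/ e p = -1) -> (forall r p, s r p = 1 \/ s r p = -1) ->
  (forall U : {set T}, U != set0 -> ~~ odd #|U| -> (#|U| <= 4)%N -> fourier s U = 0) ->
  (0 < #|A| <= 5)%N ->
  (2 ^ #|A|.-1 * \sum_r constant_on (fun p => (e p * s r p)%R) A = #|I|)%N.
Proof.
move=> sge sgs F0 /andP[A_gt0 A_le5]; apply/eqP.
rewrite -(eqr_nat int) natrM natrX sum_constant_on_fourier -?card_gt0 //.
rewrite (bigD1 set0) /= ?sub0set ?cards0 // big_set0 mul1r fourier0.
rewrite big1 ?addr0 // => U /andP[/andP[sUA eU] nU].
rewrite F0 ?mulr0 //; have := subset_leq_card sUA.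
by move: eU; case: #|U| => [|[|[|[|[|[|n]]]]]] //= _ /leq_trans/(_ A_le5).
Qed.

(* The left-hand side minus the right-hand side is [(m^2 - 1) * (m^2 - 4) / 4] for [a = 5 + m],
   except at [m = 5] and [m = -5], where both sides agree. *)
Lemma binomial_bound (a : nat) : (a <= 10)%N ->
  (5 * ('C(a, 2) + 'C(10 - a, 2)) + 126 * ('C(a, 10) + 'C(10 - a, 10))
    <= 'C(a, 5) + 'C(10 - a, 5) + 99)%N.
Proof.
have /allP h : all (fun a => 5 * ('C(a, 2) + 'C(10 - a, 2)) + 126 * ('C(a, 10) + 'C(10 - a, 10))
    <= 'C(a, 5) + 'C(10 - a, 5) + 99)%N (iota 0 11) by vm_compute.
by move=> a_le10; apply: h; rewrite mem_iota.
Qed.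

(** Let [a r] be the number of agreements of row [r] with row [i]. The moments [Q 2] and [Q 5] are
    forced, and summing [binomial_bound] over the rows bounds [Q 10], the number of rows equal to
    row [i] up to a global sign. *)
Lemma distinct_rows (I T : finType) (s : I -> T -> int) (i i' : I) :
  #|I| = 96%N -> #|T| = 10%N -> (forall r p, s r p = 1 \/ s r p = -1) ->
  (forall U : {set T}, U != set0 -> ~~ odd #|U| -> (#|U| <= 4)%N -> fourier s U = 0) ->
  i != i' -> ~~ constant_on (fun p => s i p * s i' p) [set: T].
Proof.
move=> cI cT sgs F0 nii'; apply/negP => cst.
pose sigma r p := s i p * s r p; pose a r := #|[set p | sigma r p == 1]|.
have sgsigma r p : sigma r p = 1 \/ sigma r p = -1 by apply: sign_mul.
pose Q k := (\sum_r ('C(a r, k) + 'C(10 - a r, k)))%N.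
have Q_def k : (0 < k)%N ->
    Q k = (\sum_(A | subsets_of_size k [set: T] A) \sum_r constant_on (sigma r) A)%N.
  move=> k_gt0; rewrite exchange_big; apply: eq_bigr => r _.
  by rewrite sum_constant_on_subsets // cT.
have Q_val k c : (0 < k <= 5)%N -> (2 ^ k.-1 * c = 96)%N -> Q k = ('C(10, k) * c)%N.
  move=> k_int kc; rewrite Q_def; last by case/andP: k_int.
  rewrite -cT -cardsT -sum_subsets_of_size_const; apply: eq_bigr => A /andP[_ /eqP cA].
  apply/eqP; rewrite -(eqn_pmul2l (expn_gt0 2 k.-1)) kc -cI -cA; apply/eqP.
  by apply: strength5_count; rewrite ?cA.
have : (5 * Q 2 + 126 * Q 10 <= Q 5 + 99 * #|I|)%N.
  rewrite -sum1_card !big_distrr /= -!big_split /=; apply: leq_sum => r _.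
  by rewrite muln1 binomial_bound // -cT max_card.
(* The bound reads [5 * 45 * 48 + 126 * Q 10 <= 252 * 6 + 99 * 96], that is [126 * Q 10 <= 216]. *)
rewrite cI (Q_val 2 48)%N // (Q_val 5 6)%N // (_ : 'C(10, 2) = 45)%N // (_ : 'C(10, 5) = 252)%N //.
suff : (2 <= Q 10)%N by lia.
rewrite Q_def // (bigD1 setT) /=; last by rewrite /subsets_of_size subxx cardsT cT.
rewrite (bigD1 i) //= (bigD1 i') 1?eq_sym //= cst.
have -> : constant_on (sigma i) [set: T].
  by apply/constant_onP => p q _ _; rewrite /sigma; case: (sgs i p) => ->; case: (sgs i q) => ->.
by rewrite /=; lia.
Qed.

(** * Parseval's identity and the contradiction *)

Lemma sum_even_fourier (I T : finType) (s : I -> T -> int) (A : {set T}) :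
  #|I| = 96%N -> (#|A| <= 9)%N ->
  (forall U : {set T}, U != set0 -> ~~ odd #|U| -> (#|U| <= 4)%N -> fourier s U = 0) ->
  \sum_(U : {set T} | (U \subset A) && ~~ odd #|U|) fourier s U =
  96 + \sum_(U | subsets_of_size 6 A U) fourier s U
     + \sum_(U | subsets_of_size 8 A U) fourier s U.
Proof.
move=> cI A_le9 F0; rewrite -addrA (bigD1 set0) /= ?sub0set ?cards0 // fourier0 cI.
congr (_ + _); rewrite /subsets_of_size !big_mkcondr -big_split /=.
apply: eq_bigr => U sUA.
have U_le9 := leq_trans (subset_leq_card sUA) A_le9.
move: (F0 U) U_le9; rewrite -cards_eq0.
by case: #|U| => [|[|[|[|[|[|[|[|[|[|n]]]]]]]]]] //= F0U _;
  rewrite ?addr0 ?add0r // F0U.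
Qed.

(** Expanding one factor [fourier s U] over the rows [i] leaves the even sum twisted by [s i], which
    counts the rows equal to row [i] up to a global sign: only [i] itself. *)
Lemma parseval_even (I T : finType) (s : I -> T -> int) :
  (0 < #|T|)%N -> (forall r p, s r p = 1 \/ s r p = -1) ->
  (forall i i', i != i' -> ~~ constant_on (fun p => s i p * s i' p) [set: T]) ->
  \sum_(U : {set T} | ~~ odd #|U|) fourier s U ^+ 2 = 2 ^+ #|T|.-1 * #|I|%:R.
Proof.
move=> T_gt0 sgs dist.
transitivity (\sum_i \sum_(U : {set T} | (U \subset setT) && ~~ odd #|U|)
    (\prod_(p in U) s i p) * fourier s U).
  rewrite exchange_big /=; apply: eq_big => [U|U _]; first by rewrite subsetT.
  by rewrite -big_distrl expr2.
rewrite -sumr_const big_distrr /=; apply: eq_bigr => i _.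
rewrite -sum_constant_on_fourier // -?card_gt0 ?cardsT //; congr (_ * _).
rewrite (bigD1 i) //= big1 ?addn0 => [|i' ni]; last by rewrite (negPf (dist i i' _)) // eq_sym.
suff -> : constant_on (fun p => s i p * s i p) [set: T] by [].
by apply/constant_onP => p q _ _; case: (sgs i p) => ->; case: (sgs i q) => ->.
Qed.

Lemma no_strength5_sign_array (I T : finType) (s : I -> T -> int) :
  #|I| = 96%N -> #|T| = 10%N -> (forall r p, s r p = 1 \/ s r p = -1) ->
  (forall U : {set T}, U != set0 -> ~~ odd #|U| -> (#|U| <= 4)%N -> fourier s U = 0) ->
  False.
Proof.
move=> cI cT sgs F0.
have one_sign (p : T) : (1 : int) = 1 \/ (1 : int) = -1 by left.
have even_sum (A : {set T}) : (0 < #|A| <= 9)%N -> exists N : nat,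
    96 + \sum_(U | subsets_of_size 6 A U) fourier s U
       + \sum_(U | subsets_of_size 8 A U) fourier s U = 2 ^+ #|A|.-1 * N%:R.
  move=> /andP[A_gt0 A_le9]; rewrite -sum_even_fourier //.
  exists (\sum_r constant_on (fun p => (1 * s r p)%R) A)%N.
  rewrite (sum_constant_on_fourier one_sign) -?card_gt0 //.
  by apply: eq_bigr => U _; rewrite big1 ?mul1r.
(* The division is exact in sizes 6 and 8: [even_sum] has right-hand side divisible by 32 there, and
   [96 = 3 * 32]. *)
pose k U : int := (fourier s U %/ 32)%Z.
have sum_empty j (A : {set T}) (F : {set T} -> int) : (#|A| < j)%N ->
    \sum_(U | subsets_of_size j A U) F U = 0.
  move=> A_lt; rewrite big1 // => U /andP[/subset_leq_card sUA /eqP cU].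
  by move: sUA; rewrite cU leqNgt A_lt.
have sum_full j (A : {set T}) (F : {set T} -> int) : #|A| = j ->
    \sum_(U | subsets_of_size j A U) F U = F A.
  move=> <-; rewrite (big_pred1 A) // => U /=; rewrite /subsets_of_size; apply/andP/eqP => [[sUA cU]|->].
    by apply/eqP; rewrite eqEcard sUA (eqP cU) /=.
  by split.
have k6 (U : {set T}) : #|U| = 6%N -> fourier s U = 32 * k U.
  move=> cU; have [|N] := even_sum U; first by rewrite cU.
  rewrite (sum_empty 8%N) ?(sum_full 6%N) ?cU // /k.
  move: (fourier s U) => z; rewrite -[2 ^+ _]/(32 : int); lia.
have k6_sum (A : {set T}) :
    \sum_(U | subsets_of_size 6 A U) fourier s U = 32 * \sum_(U | subsets_of_size 6 A U) k U.
  by rewrite big_distrr; apply: eq_bigr => U /andP[_ /eqP /k6].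
have k8 (U : {set T}) : #|U| = 8%N -> fourier s U = 32 * k U.
  move=> cU; have [|N] := even_sum U; first by rewrite cU.
  rewrite k6_sum (sum_full 8%N) // cU /k.
  move: (fourier s U) (\sum_(_ | _) _) => z y; rewrite -[2 ^+ _]/(128 : int); lia.
have k8_sum (A : {set T}) :
    \sum_(U | subsets_of_size 8 A U) fourier s U = 32 * \sum_(U | subsets_of_size 8 A U) k U.
  by rewrite big_distrr; apply: eq_bigr => U /andP[_ /eqP /k8].
pose x U := odd `|k U|; pose X j (A : {set T}) := (\sum_(U | subsets_of_size j A U) x U)%N.
have X_ge : (39 < X 6 [set: T] + X 8 [set: T])%N.
  have oX j A : odd (X j A) = odd `|\sum_(U | subsets_of_size j A U) k U|.
    by rewrite odd_absz_sum.
  (* Dividing [even_sum] by 32 leaves 3 plus a sum of [k U] equal to a multiple of 2, 4 or 8 for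
     [#|A|] equal to 7, 8 or 9, so that sum is odd. *)
  apply: parity_weight_bound => // A cA; rewrite ?oddD ?oddb -/(X _ _) !oX.
  - have [|N] := even_sum A; first by rewrite cA.
    rewrite k6_sum (sum_empty 8%N) ?cA //.
    by move: (\sum_(_ | _) _) => y; rewrite -[2 ^+ _]/(64 : int); lia.
  - have [|N] := even_sum A; first by rewrite cA.
    rewrite k6_sum (sum_full 8%N) // cA k8 // /x.
    by move: (\sum_(_ | _) _) (k A) => y z; rewrite -[2 ^+ _]/(128 : int); lia.
  - have [|N] := even_sum A; first by rewrite cA.
    rewrite k6_sum k8_sum cA.
    move: (\sum_(_ | _) _) (\sum_(_ | _) _) => y z; rewrite -[2 ^+ _]/(256 : int); lia.
(* The empty set contributes [96 ^+ 2] and each odd [k U] at least [32 ^+ 2]; since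
   [512 * 96 - 96 ^+ 2 = 39 * 1024], there is room for exactly 39 of them. *)
suff : (96 ^+ 2 + 1024 * (X 6 [set: T] + X 8 [set: T])%:R <= 2 ^+ 9 * 96 :> int).
  move: X_ge; move: (_ + _)%N => n; rewrite -[96 ^+ 2]/(9216 : int) -[2 ^+ 9]/(512 : int).
  lia.
have := parseval_even _ sgs (fun i i' => distinct_rows cI cT sgs F0).
rewrite cI cT => /(_ isT) <-.
rewrite (bigD1 set0) ?cards0 //= fourier0 cI lerD2l natrD !natr_sum.
rewrite mulrDr !big_distrr /= /subsets_of_size !big_mkcondr -big_split [leRHS]big_mkcond /=.
rewrite [leLHS](eq_bigl xpredT); last by move=> U; rewrite subsetT.
apply: ler_sum => U _; move: (k6 U) (k8 U); rewrite -cards_eq0.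
have x_le : (x U)%:R <= k U ^+ 2.
  rewrite /x expr2; move: (k U) => z; case: (eqVneq z 0) => [->//|nz].
  by apply: (@le_trans _ _ 1); [case: (odd _) | nia].
case: eqP => [-> /(_ erefl) -> _|_ _]; first by rewrite /= exprMn addr0; lia.
case: eqP => [-> /(_ erefl) ->|_ _]; first by rewrite /= exprMn add0r; lia.
by rewrite addr0; do 2!case: ifP => // _; apply: sqr_ge0.
Qed.

(** * From orthogonal arrays to sign arrays *)

(* [None] is the adjoined constant column. *)
Definition row_signs (n M : nat) (A : 'M[bool]_(M, n)) (r : 'I_M) (p : option 'I_n) : int :=
  if p is Some j then (-1) ^+ A r j else 1.

Lemma row_signsP (n M : nat) (A : 'M[bool]_(M, n)) r p :
  row_signs A r p = 1 \/ row_signs A r p = -1.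
Proof. by case: p => [j|] /=; [case: (A r j); [right|left] | left]. Qed.

(** The definition of an array speaks of exactly [tau] columns, so smaller sets must be padded: list
    [V] first, then its complement, and keep the first [m] entries. *)
Lemma extend_to_injection (n m : nat) (V : {set 'I_n}) :
  (#|V| <= m <= n)%N ->
  exists2 c : 'I_m -> 'I_n, injective c & forall v, v \in V -> exists j, c j = v.
Proof.
move=> /andP[V_le m_le]; case: n => [|n] in V V_le m_le *.
  have m0 : m = 0 by apply/eqP; rewrite -leqn0.
  by rewrite m0; exists id => // -[].
pose e := enum V ++ enum (~: V).
have size_e : size e = n.+1 by rewrite size_cat -!cardE cardsC card_ord.
have uniq_e : uniq e.
  rewrite cat_uniq !enum_uniq andbT /=; apply/hasPn => v.
  by rewrite !mem_enum inE.
exists (fun j : 'I_m => nth ord0 e j).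
  move=> i j /eqP; rewrite nth_uniq ?size_e ?(leq_trans (ltn_ord _)) // => /eqP.
  exact: val_inj.
move=> v vV; have idx : (index v (enum V) < m)%N.
  by rewrite (leq_trans _ V_le) // cardE index_mem mem_enum.
exists (Ordinal idx); rewrite /= nth_cat index_mem mem_enum vV.
by rewrite nth_index // mem_enum.
Qed.

(** Group the rows by their pattern on [m] columns containing [V]. All patterns are equally
    frequent, so the sum factors over these columns, and a column in [V] gives the factor
    [1 + -1]. *)
Lemma OA_sum_prod_signs (n M m : nat) (A : 'M[bool]_(M, n)) (V : {set 'I_n}) :
  is_binary_OA m A -> (m <= n)%N -> V != set0 -> (#|V| <= m)%N ->
  \sum_r \prod_(j in V) (-1) ^+ A r j = 0 :> int.
Proof.
move=> oaA m_le /set0Pn[v vV] V_le.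
have [|c c_inj c_onto] := @extend_to_injection n m V; first by rewrite V_le.
have prodE r : \prod_(j in V) (-1) ^+ A r j
    = \prod_(i : 'I_m) (if c i \in V then (-1) ^+ A r (c i) else 1) :> int.
  rewrite -big_mkcond /= -(big_imset (h := c) (fun j => (-1) ^+ A r j)) /=; last by move=> i j _ _ /c_inj.
  apply: eq_bigl => j; apply/idP/imsetP => [jV|[i iV ->] //].
  by have [i ci] := c_onto j jV; exists i => //; rewrite unfold_in /= ci.
pose pat r : {ffun 'I_m -> bool} := [ffun i => A r (c i)].
rewrite (partition_big pat xpredT) //=.
pose g (i : 'I_m) (b : bool) : int := if c i \in V then (-1) ^+ b else 1.
have sum_pat (t : {ffun 'I_m -> bool}) :
    (\sum_(r | pat r == t) \prod_(j in V) (-1) ^+ A r j) * (2 ^ m)%:R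
    = M%:R * \prod_i g i (t i).
  have -> : \sum_(r | pat r == t) \prod_(j in V) (-1) ^+ A r j
      = #|[pred r | pat r == t]|%:R * \prod_i g i (t i).
    rewrite mulr_natl -sumr_const; apply: eq_bigr => r /eqP <-.
    by rewrite prodE; apply: eq_bigr => i _; rewrite /g ffunE.
  rewrite -[in RHS](oaA c c_inj t) natrM mulrAC; congr (_%:R * _ * _).
  apply: eq_card => r; rewrite !inE; apply/eqP/forallP => [<- i|h]; first by rewrite ffunE.
  by apply/ffunP => i; rewrite ffunE; apply/eqP.
have nz : (2 ^ m)%:R != 0 :> int by rewrite pnatr_eq0 expn_eq0.
apply: (mulIf nz); rewrite mul0r big_distrl /= (eq_bigr _ (fun t _ => sum_pat t)).
rewrite -big_distrr /= -bigA_distr_bigA /=.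
have [i ci] := c_onto v vV.
by rewrite (bigD1 i) //= big_bool /g ci vV /= mul0r mulr0.
Qed.

Theorem theorem4p1 : ~ exists A : 'M[bool]_(96, 9), is_binary_OA 4 A.
Proof.
move=> [A oaA]; apply: (@no_strength5_sign_array _ _ (row_signs A)).
- by rewrite card_ord.
- by rewrite card_option card_ord.
- exact: row_signsP.
move=> U nU eU U_le; pose V := [set j | Some j \in U].
have cV : #|V| = #|U :\ None|.
  rewrite -(card_imset V (@Some_inj _)); apply: eq_card => -[j|]; rewrite !inE /=.
    by rewrite mem_imset ?inE //; apply: Some_inj.
  by apply/imsetP => -[].
rewrite /fourier (eq_bigr (fun r => \prod_(j in V) (-1) ^+ A r j)) => [|r _].
  apply: (OA_sum_prod_signs oaA) => //; last by rewrite cV (leq_trans _ U_le) ?subset_leq_card ?subD1set.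
  (* [V] is nonempty: a set [U] of even size containing [None] has another element. *)
  rewrite -card_gt0 cV; have := cardsD1 None U; move: eU; case: (None \in U) => /=; last first.
    by move=> _; rewrite add0n => <-; rewrite card_gt0.
  by move=> + e; rewrite e; case: #|U :\ None|.
rewrite (bigID (pred1 None)) /= [X in X * _]big1 ?mul1r => [|p /andP[_ /eqP->] //].
rewrite (reindex_omap Some id) /= => [|[j|] /andP[] //].
by apply: eq_big => j; rewrite /= ?inE ?eqxx ?andbT.
Qed.
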